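(* Let $\{V_n\}_{n\ge1}$ be finite sets and $E_n\subset V_n\times V_n$ be symmetric, non-diagonal sets with $|V_n|\to\infty$ and $|E_n|\to\infty$, let $$Z_n=\sum_{v_1,v_2\in V_n}\mathbf 1_{E_n}(v_1,v_2)\,X_{v_1}X_{v_2},$$ and let $G_n=(V_n,\mathcal E_n)$ be the graph associated with $Z_n$, assumed to have no isolated vertices. Let $0=\mu_1^{(n)}\le\mu_2^{(n)}\le\cdots\le\mu_{|V_n|}^{(n)}\le 2$ be the eigenvalues of the normalized Laplacian of $G_n$. Suppose that there exists $k\ge 2$ such that $$\liminf_{n\to\infty}\mu_k^{(n)}>0 .$$ Then $\{Z_n\}$ is irreducible.
   Context: $V=\bigcup_n V_n$ and $\{X_v: v\in V\}$ are i.i.d. standard normal random variables. Symmetric means $(v,w)\in E_n\Rightarrow(w,v)\in E_n$; non-diagonal means $(v,w)\in E_n\Rightarrow v\ne w$. The graph $G_n=(V_n,\mathcal E_n)$ is the simple undirected graph whose edges are the unordered pairs $\{v,w\}$ with $(v,w)\in E_n$, i.e. with adjacency matrix $A_n(v,w)=\mathbf 1_{E_n}(v,w)$. With $D_n$ the diagonal matrix of vertex degrees, the normalized Laplacian is $\mathcal L_n=I_n-D_n^{-1/2}A_nD_n^{-1/2}$; eigenvalues are listed in nondecreasing order with multiplicity. Irreducibility: for $B\subset V_n$ put $\sigma_n^2(B)=2\,|E_n\cap(B\times B)|$. The sequence $\{Z_n\}$ is reducible if for every $n$ there exist pairwise disjoint subsets $B_1,\dots,B_{m_n}\subset V_n$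 (depending on $n$) such that, as $n\to\infty$: (i) $m_n\to\infty$; (ii) $\frac{1}{2|E_n|}\sum_{i=1}^{m_n}\sigma_n^2(B_i)\to1$; (iii) $\frac{1}{2|E_n|}\max_{i=1,\dots,m_n}\sigma_n^2(B_i)\to0$. It is irreducible if no such choice of disjoint subsets exists. *)

(* Defs.v *)
From HB Require Import structures.
From mathcomp Require Import all_boot all_order all_algebra finmap.
From mathcomp Require Import all_classical all_reals all_analysis.

Set Implicit Arguments.
Unset Strict Implicit.
Unset Printing Implicit Defensive.

Import Order.TTheory GRing.Theory Num.Theory.
Import numFieldNormedType.Exports.

Local Open Scope classical_set_scope.
Local Open Scope ring_scope.

Section GaussianFamily.
Context (R : realType) (d : measure_display) (T : measurableType d).
Context (P : probability T R) (V : choiceType).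
Implicit Types X : V -> {RV P >-> R}.

Definition mutually_independent X : Prop :=
  forall (J : {fset V}) (A : V -> set R), (forall v, measurable (A v)) ->
    P (\bigcap_(v in [set` J]) (X v @^-1` A v)) =
    (\prod_(v <- J) P (X v @^-1` A v))%E.

Definition standard_normal (Y : {RV P >-> R}) : Prop :=
  forall A : set R, measurable A -> distribution P Y A = normal_prob 0 1 A.

Definition iid_standard_normal X : Prop :=
  mutually_independent X /\ forall v, standard_normal (X v).

Definition quadratic_form X (W : {fset V}) (E : {fset V * V}) (w : T) : R :=
  \sum_(v1 <- W) \sum_(v2 <- W) ((v1, v2) \in E)%:R * (X v1 w * X v2 w).

End GaussianFamily.

Section AssociatedGraph.
Context (V : choiceType).
Implicit Types (W : {fset V}) (E : {fset V * V}).

Definition symmetric_pairs E : Prop := forall v w, (v, w) \in E -> (w, v) \in E.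

Definition nondiagonal_pairs E : Prop := forall v w, (v, w) \in E -> v != w.

Definition degree W E (v : V) : nat := #|` [fset w in W | (v, w) \in E]%fset |.

Definition no_isolated_vertex W E : Prop :=
  forall v, v \in W -> (0 < degree W E v)%N.

(* Matrices indexed by W use the enumeration of the finite type [set of
   elements of W]; its choice does not affect spectra. *)
Definition vertex W (i : 'I_#|{: W}|) : V := val (enum_val i).

Definition adjacency_mx (R : realType) W E : 'M[R]_#|{: W}| :=
  \matrix_(i, j) ((vertex i, vertex j) \in E)%:R.

(* the diagonal matrix D^(-1/2) *)
Definition degree_invsqrt_mx (R : realType) W E : 'M[R]_#|{: W}| :=
  diag_mx (\row_i (Num.sqrt (degree W E (vertex i))%:R)^-1).

Definition normalized_laplacian (R : realType) W E : 'M[R]_#|{: W}| :=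
  1%:M - degree_invsqrt_mx R W E *m adjacency_mx R W E *m
         degree_invsqrt_mx R W E.

(* |E_n \cap (B x B)| is counted in ordered pairs. *)
Definition sigma2 E (B : {fset V}) : nat :=
  (2 * #|` (E `&` (B `*` B))%fset |)%N.

(* The definition of irreducibility of {Z_n} involves Z_n only through V_n and
   E_n, so these are the arguments here. *)
Definition reducible (R : realType) (W : nat -> {fset V})
    (E : nat -> {fset V * V}) : Prop :=
  exists (m : nat -> nat) (B : forall n, 'I_(m n) -> {fset V}),
    [/\ forall n i, (B n i `<=` W n)%fset,
        forall n i j, i != j -> [disjoint B n i & B n j]%fset,
        m n @[n --> \oo] --> \oo,
        ((\sum_(i < m n) sigma2 (E n) (B n i))%N%:R /
           (2 * #|` E n|)%N%:R : R) @[n --> \oo] --> (1 : R) &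
        ((\max_(i < m n) sigma2 (E n) (B n i))%N%:R /
           (2 * #|` E n|)%N%:R : R) @[n --> \oo] --> (0 : R)].

Definition irreducible (R : realType) (W : nat -> {fset V})
    (E : nat -> {fset V * V}) : Prop := ~ reducible R W E.

End AssociatedGraph.

(* s lists the eigenvalues of M in nondecreasing order, repeated according to
   multiplicity. *)
Definition spectrum_list (R : realType) (n : nat) (M : 'M[R]_n) (s : seq R) :
    Prop :=
  sorted <=%R s /\ char_poly M = \prod_(x <- s) ('X - x%:P).

(* Main.v *)
Require Import Defs.
From HB Require Import structures.
From mathcomp Require Import all_boot all_order all_algebra finmap.
From mathcomp Require Import all_classical all_reals all_analysis.
From mathcomp Require Import spectral sesquilinear.
From mathcomp.real_closed Require Import complex.
From mathcomp Require Import ring lra.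

(** If the k-th eigenvalue stays above some c > 0, the graph cannot be cut into
    many small pieces that carry almost all edges.

    Suppose that disjoint sets B_1, ..., B_m carry all but a vanishing fraction
    of the edges, while each carries only a vanishing fraction.  Since the
    pieces are small, they can be grouped greedily into k classes of nearly
    equal edge count, about |E|/k each ([balanced_grouping]).  Almost no edge
    joins two different classes ([cut_label_le]).  The k indicators of the classes, scaled
    by D^(1/2), are then orthogonal test vectors for the normalized Laplacian:
    on a combination with coefficients x_j the quadratic form is half the sum of
    (g(v) - g(w))^2 over the edges ([normalized_laplacian_form]), which sees
    only the o(|E|) edges between classes, while the squared norm is at least
    about (|E|/k) times the sum of the x_j^2 ([eigenvalue_lt_of_few_cut_pairs]).  By
    the Courant-Fischer principle the k-th eigenvalue tends to 0, which
    contradicts the lower bound c.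

    The part of the Courant-Fischer principle that is needed
    ([eigenvalue_lt_of_pos_form]) is drawn from the spectral theorem for normal
    complex matrices.  A real symmetric matrix is viewed over R[i]; the
    multiplicities in its given spectrum are matched with the spectral
    decomposition through the characteristic polynomial. *)

Set Implicit Arguments.
Unset Strict Implicit.
Unset Printing Implicit Defensive.

Import Order.TTheory GRing.Theory Num.Theory.
Import numFieldNormedType.Exports.

Local Open Scope classical_set_scope.
Local Open Scope ring_scope.

(** * An upper bound for eigenvalues by test spaces *)

Lemma char_poly_similar (F : fieldType) n (P A : 'M[F]_n) :
  P \in unitmx -> char_poly (invmx P *m A *m P) = char_poly A.
Proof.
move=> Pu; rewrite /char_poly /char_poly_mx.
have -> : 'X%:M - map_mx polyC (invmx P *m A *m P) =
  map_mx polyC (invmx P) *m ('X%:M - map_mx polyC A) *m map_mx polyC P.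
  rewrite mulmxBr mulmxBl -!map_mxM; congr (_ - _).
  rewrite mul_mx_scalar -scalemxAl -map_mxM mulVmx // map_mx1.
  by rewrite scalemx1.
rewrite !det_mulmx mulrAC -det_mulmx -map_mxM mulVmx //.
by rewrite map_mx1 det1 mul1r.
Qed.

Lemma char_poly_diag (F : fieldType) n (d : 'rV[F]_n) :
  char_poly (diag_mx d) = \prod_(i < n) ('X - (d 0 i)%:P).
Proof.
rewrite char_poly_trig ?diag_mx_is_trig //.
by apply: eq_bigr => i _; rewrite mxE eqxx.
Qed.

Local Open Scope sesquilinear_scope.

(** This is the dimension count behind the Courant-Fischer principle.  In an
    orthonormal eigenbasis, the form of [c - A] is a sum of squares weighted by
    the numbers [c - lambda].  Fewer than [k] of these weights can be positive,
    so some nonzero combination of the [k] rows of [U] has zero coordinate on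
    every eigenvector with a positive weight. *)
Lemma hermitian_nonpositive_direction (C : numClosedFieldType) n k
    (A : 'M[C]_n) (U : 'M[C]_(k, n)) (c : C) (s : seq C) :
  A \is hermsymmx -> char_poly A = \prod_(x <- s) ('X - x%:P) ->
  (count (fun x => ~~ (c <= x)%R) s < k)%N ->
  exists2 z : 'rV[C]_k, z != 0 &
    (z *m (U *m (c%:M - A) *m U ^t*) *m z ^t*) 0 0 <= 0.
Proof.
move=> hA chA cnt.
pose P := spectralmx A; pose sp := spectral_diag A.
have PU : P \is unitarymx by exact: spectral_unitarymx.
have Pu : P \in unitmx by exact: spectral_unit.
have AE : A = invmx P *m diag_mx sp *m P.
  exact/orthomx_spectralP/hermitian_normalmx.
have ps : perm_eq s [seq sp 0 i | i <- enum 'I_n].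
  apply: prod_XsubC_eq; rewrite -chA AE char_poly_similar // char_poly_diag.
  by rewrite big_map enumT.
pose low := [set i | ~~ (c <= sp 0 i)%R]%SET.
have lowk : (#|low| < k)%N.
  move: cnt; rewrite (permP ps) count_map /low -sum1dep_card -sum1_count.
  by rewrite big_enum_cond.
(* the coordinates of the rows of U in the eigenbasis *)
pose W := U *m invmx P.
(* W restricted to the eigenvalues below c; it has fewer columns than rows,
   hence a nonzero left kernel *)
pose K := colsub (fun i : 'I_#|low| => enum_val i) W.
have : (0 < \rank (kermx K))%N.
  by rewrite mxrank_ker subn_gt0 (leq_ltn_trans (rank_leq_col _)).
rewrite lt0n mxrank_eq0 => /rowV0Pn[z /sub_kermxP zK z0].
exists z => //.
pose w := z *m W.
have w0 i : ~~ (c <= sp 0 i) -> w 0 i = 0.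
  move=> hi; have il : i \in low by rewrite inE.
  have zKi : (z *m K) 0 (enum_rank_in il i) = 0 by rewrite zK mxE.
  rewrite -zKi /w !mxE; apply: eq_bigr => j _.
  by rewrite [K _ _]mxE enum_rankK_in.
have -> : z *m (U *m (c%:M - A) *m U ^t*) *m z ^t* =
          w *m diag_mx (const_mx c - sp) *m w ^t*.
  have -> : c%:M - A = invmx P *m diag_mx (const_mx c - sp) *m P.
    rewrite linearB /= diag_const_mx mulmxBr mulmxBl -AE.
    by rewrite mul_mx_scalar -scalemxAl mulVmx // scalemx1.
  rewrite /w /W !trmx_mul !map_mxM invmx_unitary // !mulmxA.
  by rewrite trmxCK.
clearbody w; rewrite mul_mx_diag mxE sumr_le0 // => i _; rewrite !mxE.
have [ci|/w0->] := boolP (c <= sp 0 i); last by rewrite !mul0r.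
by rewrite mulrAC mulr_ge0_le0 ?mul_conjC_ge0 // subr_le0.
Qed.

(** With [z = x + iy], the two cross terms cancel by symmetry of [M], and the
    Hermitian form at [z] is the sum of the real forms at [x] and at [y].  This
    lets real hypotheses feed the complex spectral theorem. *)
Lemma complexified_pos_form (R : rcfType) k (M : 'M[R]_k) :
  M^T = M -> (forall x : 'rV[R]_k, x != 0 -> 0 < (x *m M *m x^T) 0 0) ->
  forall z : 'rV[R[i]]_k, z != 0 ->
    0 < (z *m map_mx (real_complex R) M *m z ^t*) 0 0.
Proof.
move=> Msym Mpos z z0.
pose x := map_mx (@complex.Re R) z; pose y := map_mx (@complex.Im R) z.
pose f := @map_mx _ _ (real_complex R).
have zE : z = f _ _ x + 'i%C *: f _ _ y.
  by apply/rowP => j; rewrite !mxE -complexE.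
have zJ : z ^t* = f _ _ x^T - 'i%C *: f _ _ y^T.
  apply/colP => j; rewrite !mxE /=.
  by case: (z 0 j) => a b; apply: eqP; rewrite eq_complex /=; simpc.
have Mpos0 (u : 'rV_k) : 0 <= (u *m M *m u^T) 0 0.
  have [->|/Mpos/ltW//] := eqVneq u 0.
  by rewrite !mul0mx mxE.
have cross : y *m M *m x^T = x *m M *m y^T.
  have -> : x *m M *m y^T = (y *m M *m x^T)^T.
    by rewrite !trmx_mul trmxK Msym mulmxA.
  by apply/matrixP => i j; rewrite !ord1 [RHS]mxE.
have -> : z *m map_mx (real_complex R) M *m z ^t* =
    f _ _ (x *m M *m x^T + y *m M *m y^T).
  rewrite zJ zE !mulmxDl !mulmxBr -!scalemxAl -!scalemxAr /f -!map_mxM cross.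
  rewrite !scalerA -expr2 sqr_i scaleN1r opprK map_mxD.
  by rewrite addrA subrK.
rewrite mxE ltcR mxE.
have [x0|/Mpos x0] := eqVneq x 0; last by rewrite ltr_pwDl.
have /Mpos y0 : y != 0.
  apply: contra_neq z0 => y0; rewrite zE x0 y0 /f !map_mx0.
  by rewrite scaler0 addr0.
by rewrite ltr_wpDl.
Qed.

(** The half of the Courant-Fischer principle that bounds eigenvalues from
    above by means of a test space.  The rows of [U] span that space; their
    independence is implicit, since a vanishing combination would make the form
    vanish. *)
Lemma eigenvalue_lt_of_pos_form (R : rcfType) n k (A : 'M[R]_n)
    (U : 'M[R]_(k, n)) (c : R) (s : seq R) :
  A^T = A -> sorted <=%R s -> char_poly A = \prod_(x <- s) ('X - x%:P) ->
  (0 < k <= n)%N ->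
  (forall x : 'rV[R]_k, x != 0 ->
     0 < (x *m (U *m (c%:M - A) *m U^T) *m x^T) 0 0) ->
  s`_k.-1 < c.
Proof.
move=> Asym ss chA /andP[k0 kn] Upos; rewrite ltNge; apply/negP => ck.
have szs : size s = n.
  by have := size_char_poly A; rewrite chA size_prod_XsubC => -[].
(* only the first k-1 entries of the sorted list can lie below c *)
have cnt : (count (fun x => ~~ (c <= x)%R) s < k)%N.
  rewrite -(cat_take_drop k.-1 s) count_cat.
  have -> : count (fun x => ~~ (c <= x)) (drop k.-1 s) = 0%N.
    apply/eqP; rewrite -leqn0 leqNgt -has_count; apply/hasPn => x.
    move=> /(nthP 0)[l]; rewrite size_drop nth_drop => hl <-.
    rewrite negbK (le_trans ck) //.
    apply: (sorted_leq_nth le_trans (@lexx _ _) 0 ss).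
    - by rewrite inE szs (leq_trans _ kn) // prednK.
    - by rewrite inE -ltn_subRL.
    - exact: leq_addr.
  rewrite addn0 (leq_ltn_trans (count_size _ _)) //.
  by rewrite size_take_min gtn_min prednK ?leqnn.
pose f := real_complex R.
have := @hermitian_nonpositive_direction (complex R) n k (map_mx f A)
          (map_mx f U) (f c) (map f s).
case.
- apply/is_hermitianmxP; rewrite expr0 scale1r; apply/matrixP => i j.
  by rewrite !mxE /= -[in LHS]Asym mxE; apply/esym/conjc_real.
- by rewrite -map_char_poly chA map_prod_XsubC big_map.
- rewrite count_map (eq_count (a2 := fun x => ~~ (c <= x))) // => x /=.
  by rewrite lecR.
move=> z z0.
have -> : (map_mx f U) ^t* = map_mx f (U^T).
  by apply/matrixP => i j; rewrite !mxE /=; exact: conjc_real.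
have -> : (f c)%:M - map_mx f A = map_mx f (c%:M - A).
  by rewrite map_mxB map_scalar_mx.
have Msym : (U *m (c%:M - A) *m U^T)^T = U *m (c%:M - A) *m U^T.
  by rewrite !trmx_mul trmxK linearB /= tr_scalar_mx Asym mulmxA.
rewrite /f -!map_mxM => /(lt_le_trans (complexified_pos_form Msym Upos z0)).
by rewrite ltxx.
Qed.

Local Close Scope sesquilinear_scope.

(** * The quadratic form of the normalized Laplacian *)

Lemma sum_vertex (A : nmodType) (V : choiceType) (W : {fset V}) (F : V -> A) :
  \sum_(v <- W) F v = \sum_(i < #|{: W}|) F (vertex i).
Proof.
by rewrite big_seq_fsetE (reindex _ (onW_bij _ (@enum_val_bij _))).
Qed.

Section PairSums.
Context (V : choiceType) (W : {fset V}) (E : {fset V * V}).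
Context (sEW : (E `<=` W `*` W)%fset).

Lemma sum_pairs (A : nmodType) (F : V * V -> A) :
  \sum_(e <- E) F e =
  \sum_(v <- W) \sum_(w <- W) F (v, w) *+ ((v, w) \in E).
Proof.
have pE : perm_eq E [seq e <- [seq (v, w) | v <- W, w <- W] | e \in E].
  apply: uniq_perm; rewrite ?fset_uniq //.
    by rewrite filter_uniq // allpairs_uniq ?fset_uniq // => -[a b] [a' b'].
  case=> v w; rewrite mem_filter; case vwE: ((v, w) \in E) => //=.
  have := fsubsetP sEW _ vwE; rewrite inE /= => /andP[vW wW].
  by apply/esym/allpairsP; exists (v, w).
rewrite (perm_big _ pE) /= big_filter big_mkcond big_allpairs.
by apply: eq_bigr => v _; apply: eq_bigr => w _; rewrite mulrb.
Qed.

Lemma sum_pairs_fst (A : nmodType) (F : V -> A) :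
  \sum_(e <- E) F e.1 = \sum_(v <- W) F v *+ degree W E v.
Proof.
rewrite sum_pairs; apply: eq_bigr => v _; rewrite /= sumrMnr.
congr (_ *+ _); rewrite /degree card_fset_sum1 big_fset [RHS]big_mkcond.
by apply: eq_bigr => w _; case: ((v, w) \in E).
Qed.

Lemma sum_pairs_swap (A : nmodType) (F : V * V -> A) :
  symmetric_pairs E -> \sum_(e <- E) F e = \sum_(e <- E) F (e.2, e.1).
Proof.
move=> Esym; rewrite !sum_pairs exchange_big /=.
apply: eq_bigr => v _; apply: eq_bigr => w _; congr (_ *+ _).
by congr nat_of_bool; apply/idP/idP => /Esym.
Qed.

End PairSums.

Section LaplacianForm.
Context (R : realType) (V : choiceType) (W : {fset V}) (E : {fset V * V}).
Context (sEW : (E `<=` W `*` W)%fset) (Esym : symmetric_pairs E).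
Context (hiso : no_isolated_vertex W E).

(** The vector D^(1/2) g.  In this scaling the normalized Laplacian becomes the
    Dirichlet form of [g] and the Euclidean norm becomes the sum of [g ^+ 2]
    over the first endpoints of the edges. *)
Definition degree_scaled (g : V -> R) : 'rV[R]_#|{: W}| :=
  \row_i (Num.sqrt (degree W E (vertex i))%:R * g (vertex i)).

Lemma degree_scaled_sqr (g : V -> R) :
  (degree_scaled g *m (degree_scaled g)^T) 0 0 = \sum_(e <- E) g e.1 ^+ 2.
Proof.
rewrite (sum_pairs_fst sEW (fun v => g v ^+ 2)) sum_vertex mxE.
apply: eq_bigr => i _; rewrite !mxE -expr2 exprMn sqr_sqrtr ?ler0n //.
by rewrite mulr_natl.
Qed.

Lemma degree_scaled_invsqrt (g : V -> R) :
  degree_scaled g *m degree_invsqrt_mx R W E = \row_i g (vertex i).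
Proof.
apply/rowP => i; rewrite mul_mx_diag !mxE mulrAC divff ?mul1r //.
by rewrite sqrtr_eq0 -ltNge ltr0n hiso // /vertex fsvalP.
Qed.

Lemma degree_invsqrt_tr : (degree_invsqrt_mx R W E)^T = degree_invsqrt_mx R W E.
Proof. by rewrite tr_diag_mx. Qed.

Lemma normalized_laplacian_tr :
  (normalized_laplacian R W E)^T = normalized_laplacian R W E.
Proof.
rewrite /normalized_laplacian linearB /= tr_scalar_mx !trmx_mul.
rewrite degree_invsqrt_tr mulmxA; congr (_ - _ *m _ *m _).
apply/matrixP => i j; rewrite !mxE; congr (nat_of_bool _)%:R.
by apply/idP/idP => /Esym.
Qed.

Lemma normalized_laplacian_form (g : V -> R) :
  (degree_scaled g *m normalized_laplacian R W E *m (degree_scaled g)^T) 0 0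
  = \sum_(e <- E) (g e.1 - g e.2) ^+ 2 / 2.
Proof.
rewrite /normalized_laplacian mulmxBr mulmx1 mulmxBl mxE degree_scaled_sqr.
have -> : degree_scaled g *m (degree_invsqrt_mx R W E *m adjacency_mx R W E *m
      degree_invsqrt_mx R W E) *m (degree_scaled g)^T =
    (\row_i g (vertex i)) *m adjacency_mx R W E *m (\row_i g (vertex i))^T.
  rewrite -degree_scaled_invsqrt trmx_mul degree_invsqrt_tr.
  by rewrite !mulmxA.
have -> : (- ((\row_i g (vertex i)) *m adjacency_mx R W E *m
      (\row_i g (vertex i))^T)) 0 0 = - \sum_(e <- E) g e.1 * g e.2.
  rewrite mxE; congr (- _); rewrite (sum_pairs sEW) exchange_big sum_vertex.
  rewrite mxE; apply: eq_bigr => j _; rewrite sum_vertex mxE mulr_suml.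
  by apply: eq_bigr => i _; rewrite !mxE mulrAC mulr_natr.
(* by symmetry of E, the halved squares at the first and at the second
   endpoints have equal sums *)
have -> : \sum_(e <- E) (g e.1 - g e.2) ^+ 2 / 2 =
   \sum_(e <- E) ((g e.1 ^+ 2 / 2 - g e.1 * g e.2) + g e.2 ^+ 2 / 2).
  by apply: eq_bigr => e _; field.
rewrite big_split /= -(sum_pairs_swap sEW (fun e => g e.1 ^+ 2 / 2)) //.
rewrite -big_split -sumrB /=.
by apply: eq_bigr => e _; field.
Qed.

End LaplacianForm.

(** * Test functions constant on the classes of a partition *)

Definition cut_count (V : choiceType) (L : eqType) (rho : V -> L)
    (E : {fset V * V}) : nat :=
  count (fun e => rho e.1 != rho e.2) E.

Definition block_count (V : choiceType) (L : eqType) (rho : V -> L)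
    (E : {fset V * V}) (l : L) : nat :=
  count (fun e => (rho e.1 == l) && (rho e.2 == l)) E.

Section Partition.
Context (R : realType) (V : choiceType) (W : {fset V}) (E : {fset V * V}).
Context (k : nat) (rho : V -> option 'I_k).

(** The value is [0] on the vertices labelled [None], which thus form one
    additional class on which the test functions are constant. *)
Definition step_function (x : 'rV[R]_k) (v : V) : R := oapp (x 0) 0 (rho v).

Lemma step_function_sqr_le (x : 'rV[R]_k) v :
  step_function x v ^+ 2 <= \sum_j x 0 j ^+ 2.
Proof.
rewrite /step_function; case: (rho v) => [j|] /=.
  by rewrite (bigD1 j) //= lerDl sumr_ge0 // => i _; exact: sqr_ge0.
by rewrite expr0n sumr_ge0 // => i _; exact: sqr_ge0.
Qed.

(** Pairs with equal labels contribute nothing.  For the others,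
    [(a - b) ^+ 2 <= 2 * (a ^+ 2 + b ^+ 2)] and each square is at most the sum
    of all [x 0 j ^+ 2]. *)
Lemma step_function_variation (x : 'rV[R]_k) :
  \sum_(e <- E) (step_function x e.1 - step_function x e.2) ^+ 2 / 2 <=
  \sum_j x 0 j ^+ 2 * (2 * (cut_count rho E)%:R).
Proof.
have -> : \sum_j x 0 j ^+ 2 * (2 * (cut_count rho E)%:R) =
   \sum_(e <- E | rho e.1 != rho e.2) 2 * \sum_j x 0 j ^+ 2.
  rewrite -mulr_suml big_const_seq iter_addr_0 -[RHS]mulr_natr /cut_count.
  by rewrite mulrCA mulrA.
rewrite [leRHS]big_mkcond; apply: ler_sum => e _.
case: eqP => [eq_rho|_] /=.
  by rewrite /step_function eq_rho subrr expr0n mul0r.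
have := step_function_sqr_le x e.1; have := step_function_sqr_le x e.2.
move: (step_function x e.1) (step_function x e.2) (\sum_j _) => a b M bM aM.
have := sqr_ge0 (a + b); nra.
Qed.

Lemma step_function_norm (x : 'rV[R]_k) :
  \sum_j x 0 j ^+ 2 * (block_count rho E (Some j))%:R <=
  \sum_(e <- E) step_function x e.1 ^+ 2.
Proof.
under eq_bigr => j _.
  rewrite /block_count -sum1_count natr_sum big_mkcond mulr_sumr; over.
rewrite exchange_big; apply: ler_sum => e _ /=.
rewrite /step_function; case: (rho e.1) => [j|] /=.
  rewrite (bigD1 j) //= big1 ?addr0 => [|i /negPf ij].
    by rewrite eqxx /=; case: ifP => _; rewrite ?mulr1 ?mulr0 ?sqr_ge0.
  rewrite (_ : Some j == Some i = false) ?mulr0 //.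
  by apply/eqP => -[ji]; rewrite ji eqxx in ij.
by rewrite big1 ?sqr_ge0 // => i _; rewrite mulr0.
Qed.

Context (sEW : (E `<=` W `*` W)%fset) (Esym : symmetric_pairs E).
Context (hiso : no_isolated_vertex W E).

(** The test space is spanned by the scaled indicators of the [k] labels.  On a
    step function with values [x], the Dirichlet form is at most
    [2 * cut * sum (x j ^+ 2)] and the squared norm is at least
    [sum (x j ^+ 2 * block j)], so the Rayleigh quotient stays below [c]. *)
Lemma eigenvalue_lt_of_few_cut_pairs (c : R) (s : seq R) :
  spectrum_list (normalized_laplacian R W E) s ->
  (0 < k <= #|` W|)%N -> 0 < c ->
  (forall j : 'I_k,
     2 * (cut_count rho E)%:R < c * (block_count rho E (Some j))%:R) ->
  s`_k.-1 < c.
Proof.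
move=> [ss chs] kW c0 cut.
pose U : 'M[R]_(k, _) := \matrix_j degree_scaled W E
  (fun v => (rho v == Some j)%:R).
have UE (x : 'rV_k) : x *m U = degree_scaled W E (step_function x).
  apply/rowP => i; rewrite !mxE /step_function.
  under eq_bigr => l _ do rewrite !mxE mulrCA.
  rewrite -mulr_sumr; congr (_ * _); case: (rho (vertex i)) => [j|] /=.
    rewrite (bigD1 j) //= eqxx mulr1 big1 ?addr0 // => l /negPf lj.
    by rewrite (_ : Some j == Some l = false) ?mulr0 // -lj eq_sym.
  by rewrite big1 // => l _; rewrite mulr0.
apply: (@eigenvalue_lt_of_pos_form _ _ _ (normalized_laplacian R W E) U c s).
- exact: normalized_laplacian_tr.
- exact: ss.
- exact: chs.
- by rewrite -cardfE.
move=> x x0.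
have -> : (x *m (U *m (c%:M - normalized_laplacian R W E) *m U^T) *m x^T) 0 0 =
    c * (\sum_(e <- E) step_function x e.1 ^+ 2) -
    \sum_(e <- E) (step_function x e.1 - step_function x e.2) ^+ 2 / 2.
  rewrite -(normalized_laplacian_form sEW Esym hiso) -(degree_scaled_sqr sEW).
  rewrite -UE; have -> : x *m (U *m (c%:M - normalized_laplacian R W E) *m U^T)
      *m x^T = x *m U *m (c%:M - normalized_laplacian R W E) *m (x *m U)^T.
    by rewrite trmx_mul !mulmxA.
  rewrite mulmxBr mulmxBl mul_mx_scalar -scalemxAl.
  by rewrite [LHS]mxE [X in X + _]mxE [X in _ + X]mxE.
rewrite subr_gt0 (le_lt_trans (step_function_variation x)) //.
rewrite (lt_le_trans _ (ler_wpM2l (ltW c0) (step_function_norm x))) //.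
rewrite mulr_sumr; have [j xj0] : exists j, x 0 j != 0.
  apply/existsP; rewrite -negb_forall; apply: contra x0 => /forallP x0.
  by apply/eqP/rowP => j; rewrite mxE; exact/eqP.
rewrite [ltLHS](bigD1 j) //= [ltRHS](bigD1 j) //=; apply: ltr_leD.
  by rewrite [ltRHS]mulrCA ltr_pM2l // exprn_even_gt0.
apply: ler_sum => i _; rewrite [leRHS]mulrCA.
by rewrite ler_wpM2l ?sqr_ge0 // ltW.
Qed.

End Partition.

(** * Grouping a disjoint family into balanced classes *)

(** Group [j] consists of the indices at which the running total lies in
    [[j * T, j.+1 * T)].  The total at the first index of this kind overshoots
    [j * T] by less than one term, hence by at most [M], and from there on every
    term counts for the group until the running total passes [j.+1 * T]. *)
Lemma leq_group_sum (t : nat -> nat) (M T j n : nat) :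
  (0 < T)%N -> (forall i, t i <= M)%N ->
  (minn (\sum_(i < n) t i) (j.+1 * T) <=
   j * T + M + \sum_(i < n | (\sum_(l < i) t l) %/ T == j) t i)%N.
Proof.
move=> T0 tM; elim: n => [|n IHn]; first by rewrite big_ord0 min0n.
rewrite big_ord_recr /= [X in (_ <= _ + X)%N]big_mkcond big_ord_recr /=.
rewrite -big_mkcond /=.
move: IHn; set F := (\sum_(i < n) t i)%N.
set G := (\sum_(i < n | _) t i)%N => IHn.
have tn := tM n.
have [Fj|jF] := ltnP F (j * T).
  rewrite (leq_trans (geq_minl _ _)) // (leq_trans _ (leq_addr _ _)) //.
  by rewrite leq_add // ltnW.
have [Fj|jF'] := ltnP F (j.+1 * T); last first.
  move: IHn; rewrite (minn_idPr jF') => IHn.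
  by rewrite (leq_trans (geq_minr _ _)) // addnA (leq_trans IHn) ?leq_addr.
have -> : (F %/ T)%N == j.
  by rewrite eqn_leq -ltnS ltn_divLR // Fj leq_divRL.
move: IHn; rewrite (minn_idPl (ltnW Fj)) => IHn.
by rewrite (leq_trans (geq_minl _ _)) // addnA leq_add2r.
Qed.

(** Terms that come after the running total has reached [k * T] are left
    ungrouped. *)
Lemma balanced_grouping (m k M T : nat) (s : 'I_m -> nat) :
  (0 < T)%N -> (k * T <= \sum_i s i)%N -> (forall i, s i <= M)%N ->
  exists gamma : 'I_m -> option 'I_k, forall j : 'I_k,
    (T <= M + \sum_(i | gamma i == Some j) s i)%N.
Proof.
move=> T0 kT sM.
pose t (i : nat) : nat := oapp s 0%N (insub i).
have tE (i : 'I_m) : t i = s i by rewrite /t valK.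
have tM i : (t i <= M)%N by rewrite /t; case: insub.
exists (fun i => insub ((\sum_(l < i) t l) %/ T)%N) => j.
have := leq_group_sum j m T0 tM.
have -> : (\sum_(i < m) t i = \sum_i s i)%N by apply: eq_bigr => i _.
have jT : (j.+1 * T <= \sum_i s i)%N.
  by rewrite (leq_trans _ kT) // leq_mul2r ltn_ord orbT.
rewrite (minn_idPr jT) mulSn -addnA addnC leq_add2l.
congr (_ <= _ + _)%N; apply: eq_big => // i.
by case: insubP => [l _ <-|] //; apply: contraNF => /eqP ->; exact: ltn_ord.
Qed.

Lemma sum_indicator_le (I : finType) (p q : pred I) (b : bool) :
  (forall i j, q i -> q j -> i = j) -> (forall i, p i -> q i -> b) ->
  (\sum_(i | p i) q i <= b)%N.
Proof.
move=> q1 pqb; have [i /andP[pi qi]|none] := pickP [pred i | p i && q i].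
  rewrite (bigD1 i) //= qi (pqb i) // big1 // => j /andP[_ ji].
  by apply/eqP; rewrite eqb0; apply: contra ji => qj; rewrite (q1 _ _ qj qi).
by rewrite big1 // => i pi; move: (none i); rewrite /= pi /= => ->.
Qed.

Section DisjointFamily.
Context (V : choiceType) (E : {fset V * V}) (m k : nat).
Context (B : 'I_m -> {fset V}) (gamma : 'I_m -> option 'I_k).
Context (disjB : forall i j, i != j -> [disjoint B i & B j]%fset).

Definition inner_count (i : 'I_m) : nat :=
  count (fun e => (e.1 \in B i) && (e.2 \in B i)) E.

(** A vertex outside the family and a vertex of an ungrouped member both get
    the label [None]. *)
Definition label (v : V) : option 'I_k :=
  obind gamma [pick i | v \in B i].

Lemma in_disjoint_unique i j v : v \in B i -> v \in B j -> i = j.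
Proof.
move=> vi vj; apply/eqP/negPn/negP => /disjB.
by move=> /fdisjointP/(_ _ vi); rewrite vj.
Qed.

Lemma label_in i v : v \in B i -> label v = gamma i.
Proof.
move=> vi; rewrite /label; case: pickP => [j vj|/(_ i)]; last by rewrite vi.
by rewrite (in_disjoint_unique vi vj).
Qed.

Lemma sigma2_inner i : sigma2 E (B i) = (2 * inner_count i)%N.
Proof.
rewrite /sigma2 /inner_count -size_filter; congr (2 * _)%N.
apply: perm_size; apply: uniq_perm; rewrite ?filter_uniq ?fset_uniq // => e.
by rewrite mem_filter !inE andbC.
Qed.

Lemma sum_inner_le (p : pred 'I_m) (q : pred (V * V)) :
  (forall i e, p i -> e.1 \in B i -> e.2 \in B i -> q e) ->
  (\sum_(i | p i) inner_count i <= count q E)%N.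
Proof.
move=> pq; under eq_bigr do rewrite /inner_count -sum1_count big_mkcond.
rewrite -sum1_count [leqRHS]big_mkcond exchange_big /=; apply: leq_sum => e _.
have -> : (if q e then 1 else 0)%N = q e by case: (q e).
rewrite (eq_bigr (fun i => nat_of_bool ((e.1 \in B i) && (e.2 \in B i)))).
  2: by move=> i _; case: (_ && _).
apply: sum_indicator_le.
- by move=> i j /andP[+ _] /andP[+ _]; exact: in_disjoint_unique.
- by move=> i pi /andP[]; exact: pq.
Qed.

(** A pair inside one member of the family has equal labels at both ends,
    whether or not that member is grouped. *)
Lemma cut_label_le :
  (cut_count label E + \sum_i inner_count i <= #|` E|)%N.
Proof.
rewrite -(count_predC (fun e => label e.1 != label e.2) E) leq_add2l.
apply: sum_inner_le => i e _ e1 e2.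
by rewrite /= negbK (label_in e1) (label_in e2).
Qed.

Lemma block_label_ge j :
  (\sum_(i | gamma i == Some j) inner_count i <=
   block_count label E (Some j))%N.
Proof.
apply: sum_inner_le => i e gi e1 e2.
by rewrite (label_in e1) (label_in e2) gi.
Qed.

End DisjointFamily.

(** The explicit estimate for a single graph.  The term [- 2] absorbs the
    rounding of the group size to an integer, and the maximum absorbs the
    imbalance of the grouping. *)
Lemma eigenvalue_lt_of_disjoint_family (R : realType) (V : choiceType)
    (W : {fset V}) (E : {fset V * V}) (k m : nat) (B : 'I_m -> {fset V})
    (c : R) (s : seq R) :
  (E `<=` W `*` W)%fset -> symmetric_pairs E -> no_isolated_vertex W E ->
  spectrum_list (normalized_laplacian R W E) s ->
  (forall i j, i != j -> [disjoint B i & B j]%fset) ->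
  (0 < k <= #|` W|)%N -> 0 < c ->
  2 * ((2 * #|` E|)%N%:R - (\sum_(i < m) sigma2 E (B i))%N%:R) <
  c * ((\sum_(i < m) sigma2 E (B i))%N%:R / k%:R - 2 -
       (\max_(i < m) sigma2 E (B i))%N%:R) ->
  s`_k.-1 < c.
Proof.
move=> sEW Esym hiso hs disjB kW c0 key.
pose e i := inner_count E B i.
pose S := (\sum_i e i)%N.
have SE : (\sum_(i < m) sigma2 E (B i) = 2 * S)%N.
  by rewrite big_distrr; apply: eq_bigr => i _; exact: sigma2_inner.
pose M := (\max_(i < m) sigma2 E (B i))./2.
have eM i : (e i <= M)%N.
  by rewrite -[e i]doubleK half_leq // -mul2n -sigma2_inner (leq_bigmax i).
have M2 : (M%:R * 2 : R) <= (\max_(i < m) sigma2 E (B i))%N%:R.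
  by rewrite -natrM ler_nat muln2 -[leqRHS]odd_double_half leq_addl.
(* the size that each of the k groups has to reach, up to one member *)
pose T := (S %/ k)%N.
have k0 : (0 < k)%N by case/andP: kW.
have kR : 0 < k%:R :> R by rewrite ltr0n.
have ST : S%:R / k%:R < T%:R + 1 :> R.
  by rewrite ltr_pdivrMr // natr1 -natrM ltr_nat ltn_ceil.
have key' : 2 * (#|` E|%:R - S%:R) < c * (T%:R - M%:R).
  move: key; rewrite SE !natrM -mulrA.
  move: ST M2; set x := S%:R / k%:R; set y := _%:R; nra.
have SleE : (S <= #|` E|)%N.
  exact: leq_trans (leq_addl _ _) (cut_label_le E (fun=> @None 'I_k) disjB).
have TM : (M < T)%N.
  rewrite -(ltr_nat R) -subr_gt0 -(pmulr_rgt0 _ c0) (le_lt_trans _ key') //.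
  by rewrite mulr_ge0 // subr_ge0 ler_nat.
have kTS : (k * T <= \sum_i e i)%N by rewrite mulnC leq_trunc_div.
have [gamma bal] := balanced_grouping (leq_ltn_trans (leq0n _) TM) kTS eM.
apply: (eigenvalue_lt_of_few_cut_pairs (rho := label B gamma) sEW) => // j.
have cutR : (cut_count (label B gamma) E)%:R + S%:R <= #|` E|%:R :> R.
  by rewrite -natrD ler_nat; exact: cut_label_le.
have blockR : T%:R <= M%:R + (block_count (label B gamma) E (Some j))%:R :> R.
  rewrite -natrD ler_nat (leq_trans (bal j)) // leq_add2l.
  exact: block_label_ge.
rewrite (le_lt_trans _ (lt_le_trans key' _)) //.
  by rewrite ler_pM2l // lerBrDr.
by rewrite ler_pM2l // lerBlDl.
Qed.

(** * Asymptotics *)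

Lemma eventually_ge_of_limn_einf_gt0 (R : realType) (u : nat -> R) :
  (0 < limn_einf (fun n => (u n)%:E))%E ->
  exists2 c : R, 0 < c & \forall n \near \oo, c <= u n.
Proof.
rewrite limn_einf_lim (cvg_lim _ (@cvg_einfs_sup R _)) //.
move=> /ereal_sup_gt[_ [N _ <-] eN0].
have leN n : (N <= n)%N -> (einfs (fun n => (u n)%:E) N <= (u n)%:E)%E.
  by move=> Nn; apply: ereal_inf_lbound; exists n.
have eNfin : einfs (fun n => (u n)%:E) N \is a fin_num.
  rewrite fin_real // (lt_le_trans _ (ltW eN0)) ?ltNy0 //=.
  by rewrite (le_lt_trans (leN N _)) ?ltry.
exists (fine (einfs (fun n => (u n)%:E) N)).
  by rewrite fine_gt0 // eN0 -ge0_fin_numE // ltW.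
by exists N => // n /= Nn; rewrite -lee_fin fineK // leN.
Qed.

Theorem theorem2p6 (R : realType) (d : measure_display) (T : measurableType d)
    (P : probability T R) (V : choiceType)
    (Vn : nat -> {fset V}) (En : nat -> {fset V * V})
    (hV : forall v, exists n, v \in Vn n)
    (X : V -> {RV P >-> R}) (hX : iid_standard_normal X)
    (hE : forall n, (En n `<=` Vn n `*` Vn n)%fset)
    (hsym : forall n, symmetric_pairs (En n))
    (hdiag : forall n, nondiagonal_pairs (En n))
    (hVoo : #|` Vn n| @[n --> \oo] --> \oo)
    (hEoo : #|` En n| @[n --> \oo] --> \oo)
    (Z : nat -> T -> R)
    (hZ : forall n, Z n = quadratic_form X (Vn n) (En n))
    (hiso : forall n, no_isolated_vertex (Vn n) (En n))
    (mu : nat -> seq R)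
    (hmu : forall n,
        spectrum_list (normalized_laplacian R (Vn n) (En n)) (mu n))
    (hk : exists2 k : nat, (2 <= k)%N &
        (0 < limn_einf (fun n => ((mu n)`_k.-1)%:E))%E) :
  irreducible R Vn En.
Proof.
case: hk => k k2 /eventually_ge_of_limn_einf_gt0[c c0 mu_ge].
case=> m [B [_ disjB _ sum_cvg max_cvg]].
have k0 : 0 < k%:R :> R by rewrite ltr0n ltnW.
pose a n : R := (\sum_(i < m n) sigma2 (En n) (B n i))%N%:R /
           (2 * #|` En n|)%N%:R.
pose b n : R := (\max_(i < m n) sigma2 (En n) (B n i))%N%:R /
           (2 * #|` En n|)%N%:R.
(* Once |E_n| >= 2k, the rounding term 1/|E_n| is at most 1/(2k), and gap n is
   at most the margin in the estimate for a single graph, divided by 2|E_n|. *)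
pose gap n := c * (a n / k%:R - (2 * k%:R)^-1 - b n) - 2 * (1 - a n).
have gap_cvg : gap n @[n --> \oo] -->
    c * (1 / k%:R - (2 * k%:R)^-1 - 0) - 2 * (1 - 1).
  apply: cvgB; apply: cvgMr; last by apply: cvgB => //; exact: cvg_cst.
  apply: cvgB => //; apply: cvgB; last exact: cvg_cst.
  exact: cvgMl.
have lim_gt0 : 0 < c * (1 / k%:R - (2 * k%:R)^-1 - 0) - 2 * (1 - 1).
  rewrite subrr mulr0 !subr0 mulr_gt0 // subr_gt0 mul1r.
  by rewrite ltf_pV2 ?posrE ?mulr_gt0 // ltr_pMl // ltr1n.
have gap_gt0 : \forall n \near \oo, 0 < gap n by exact: (cvgr_gt _ gap_cvg).
have Vlarge : \forall n \near \oo, (k <= #|` Vn n|)%N.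
  by exact: (cvgnyPge _).1.
have Elarge : \forall n \near \oo, (2 * k <= #|` En n|)%N.
  by exact: (cvgnyPge _).1.
have [N _] : \forall n \near \oo, False; last by move/(_ N (leqnn N)).
near=> n.
have Vk : (k <= #|` Vn n|)%N by near: n.
have Ek : (2 * k <= #|` En n|)%N by near: n.
have cn : c <= (mu n)`_k.-1 by near: n.
have gn : 0 < gap n by near: n.
suff : (mu n)`_k.-1 < c by rewrite ltNge cn.
apply: (eigenvalue_lt_of_disjoint_family (hE n) (hsym n) (@hiso n) (hmu n)
  (disjB n)) => //; first by rewrite Vk andbT ltnW.
have E0 : 0 < (2 * #|` En n|)%N%:R :> R.
  by rewrite ltr0n muln_gt0 /= (leq_trans _ Ek) // muln_gt0 /= ltnW.
have invE : (2 * #|` En n|)%N%:R * (2 * k%:R)^-1 >= 2 :> R.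
  by rewrite ler_pdivlMr ?mulr_gt0 // -!natrM ler_nat leq_mul2l.
move: gn; rewrite -(pmulr_rgt0 _ E0) /gap /a /b.
set x := (\sum_(i < _) _)%N%:R; set y := (\max_(i < _) _)%N%:R.
move: E0 invE; set e := (2 * _)%N%:R => E0 invE.
have -> : e * (c * (x / e / k%:R - (2 * k%:R)^-1 - y / e) - 2 * (1 - x / e)) =
   c * (x / k%:R - e * (2 * k%:R)^-1 - y) - 2 * (e - x).
  (* e is kept opaque, so that the cast of the product is not distributed *)
  by clearbody e; field; rewrite (gt_eqF k0) (gt_eqF E0).
rewrite subr_gt0 => /lt_le_trans; apply.
by rewrite ler_pM2l // lerD2r lerD2l lerN2.
Unshelve. all: by end_near.
Qed.
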